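(* Let $p$ be a prime and $n$ a positive integer, and let $S:=\{\mathbf x\in\mathbb Z_p^n:\ \mathrm d(\mathbf x,\mathbf 1)\le p\sqrt n\}$. Then $\chi(\mathsf{Cay}(\mathbb Z_p^n,S))\ge \sqrt n/p^3$. Furthermore, for each fixed $p$ there is a constant $c_p>0$ such that for all sufficiently large $n$, $\alpha(\mathsf{Cay}(\mathbb Z_p^n,S))\ge c_p\,p^n$.
   Context: $\mathbb Z_p=\mathbb Z/p\mathbb Z$, $\mathbf 1$ is the all-ones vector in $\mathbb Z_p^n$, and $\mathrm d(\cdot,\cdot)$ is the Hamming distance (number of coordinates in which two vectors differ). $\mathsf{Cay}(\Gamma,S)$ is the Cayley digraph with arc $u\to v$ iff $v-u\in S$; $\chi$ and $\alpha$ (chromatic number and independence number) refer to its underlying undirected graph. *)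

(* Defs.v *)
From mathcomp Require Import all_boot all_algebra.
From Stdlib Require Import Reals.
Set Implicit Arguments. Unset Strict Implicit. Unset Printing Implicit Defensive.
Import GRing.Theory.

(* Proper k-colourings of the simple graph underlying a relation e
   (edges are unordered pairs {x,y} with x != y and e x y; loops ignored). *)
Definition colorable (T : finType) (e : rel T) (k : nat) : bool :=
  [exists f : {ffun T -> 'I_k},
     [forall x, [forall y, ((x != y) && e x y) ==> (f x != f y)]]].

Lemma colorable_exists (T : finType) (e : rel T) : exists k, colorable e k.
Proof.
exists #|T|; apply/existsP; exists [ffun x => enum_rank x].
apply/forallP=> x; apply/forallP=> y; apply/implyP=> /andP[nxy _].
by rewrite !ffunE; apply: contra nxy => /eqP/enum_rank_inj ->.
Qed.

Definition chromatic_number (T : finType) (e : rel T) : nat :=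
  ex_minn (colorable_exists e).

Definition independent (T : finType) (e : rel T) (A : {set T}) : bool :=
  [forall x in A, [forall y in A, (x != y) ==> ~~ e x y]].

Definition independence_number (T : finType) (e : rel T) : nat :=
  \max_(A : {set T} | independent e A) #|A|.

(* Underlying undirected graph of the Cayley digraph Cay(Z_p^n, S):
   arc u -> v iff v - u \in S; u ~ v iff u != v and (v-u \in S or u-v \in S). *)
Definition cayley_rel (p n : nat) (S : pred 'rV['F_p]_n) : rel 'rV['F_p]_n :=
  fun u v => (u != v) && ((GRing.add v (GRing.opp u) \in S) || (GRing.add u (GRing.opp v) \in S)).

Definition hamming (p n : nat) (x y : 'rV['F_p]_n) : nat :=
  #|[set i : 'I_n | x ord0 i != y ord0 i]|.

Definition S_ball (p n : nat) : pred 'rV['F_p]_n :=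
  fun x => if Rle_dec (INR (hamming x (const_mx (GRing.one 'F_p)))) (INR p * sqrt (INR n))
           then true else false.

Definition cayS (p n : nat) : rel 'rV['F_p]_n := cayley_rel (@S_ball p n).

(* Main.v *)
(** Chromatic number.  A colouring with k colours yields an equivariant labelling
of the faces of the join of n copies of Z_p.  A Z_p-analogue of Fan's lemma then
finds a maximal flag of faces along which consecutive labels differ.  To a face s
leaving few coordinates free, attach the largest colour m(s) of its completions.
Completions of s and of s + 1 are adjacent, so the set T of shifts g maximising
m(s - g) is a proper subset of Z_p, and the mean of T is an equivariant label.  It
changes along a flag only if the pair (max m, #|T|) increases lexicographically,
which can happen fewer than k (p - 1) times.

The Fan-type lemma is homological: the cup powers of the Bockstein class of Z_p,
pulled back by the labelling, pair to 1 with the standard generating chains of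
the subdivided join, and these cocycles vanish on sequences with a repeated
consecutive entry.

Independence number.  Let N_a(x) count the coordinates of x equal to a.  The
vectors with N_0 > n/p + p sqrt n and N_1 <= n/p form an independent set, since
adding 1 turns N_0 into N_1.  By Chebyshev's inequality half of all vectors have
N_0 and N_1 within O(sqrt n) of n/p; changing O(sqrt n) of their ones into zeros
lands in that set, and the ratio of the numbers of choices forwards and backwards
is bounded. *)

Require Import Defs.
From mathcomp Require Import all_boot all_order all_algebra.
From mathcomp Require Import zify ring.
From Stdlib Require Import Classical.
Set Implicit Arguments. Unset Strict Implicit. Unset Printing Implicit Defensive.
Import Order.TTheory GRing.Theory Num.Theory.
Local Open Scope ring_scope.

(** * Boundaries of lists *)

Section Boundary.
Variables (T : eqType) (R : comNzRingType).
Implicit Types (H : seq T -> R) (s : seq T).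

(* [bd H] is [H] evaluated on the alternating sum of the one-point deletions of
   its argument, so it is at once the boundary of chains and the coboundary of
   cochains. *)
Fixpoint bd H s : R :=
  if s is v :: t then H t - bd (fun u => H (v :: u)) t else 0.

Lemma bdB H H' s : bd (fun t => H t - H' t) s = bd H s - bd H' s.
Proof. by elim: s H H' => [|v s IH] H H' /=; rewrite ?IH; ring. Qed.

Lemma bdZ a H s : bd (fun t => a * H t) s = a * bd H s.
Proof. by elim: s H => [|v s IH] H /=; rewrite ?IH; ring. Qed.

Lemma bd_sum (I : finType) (H : I -> seq T -> R) s :
  bd (fun t => \sum_i H i t) s = \sum_i bd (H i) s.
Proof.
elim: s H => [|v s IH] H /=; first by rewrite big1.
by rewrite IH sumrB.
Qed.

Lemma bd_bd H s : bd (bd H) s = 0.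
Proof.
elim: s H => [|v s IH] H //=.
by rewrite bdB IH subr0 subrr.
Qed.

Lemma eq_bd H H' s :
  (forall t, subseq t s -> (size t).+1 = size s -> H t = H' t) -> bd H s = bd H' s.
Proof.
elim: s H H' => [|v s IH] H H' eqH //=; congr (_ - _).
  by apply: eqH => //; apply: subseq_cons.
apply: IH => t sub_ts sz_t; apply: eqH; rewrite /= ?eqxx ?sz_t //.
Qed.

Lemma bd_neq0 H s : bd H s != 0 ->
  exists t, [/\ subseq t s, (size t).+1 = size s & H t != 0].
Proof.
elim: s H => [|v s IH] H /=; first by rewrite eqxx.
have [Hs0|Hs _] := eqVneq (H s) 0; last first.
  by exists s; split => //; apply: subseq_cons.
rewrite Hs0 sub0r oppr_eq0 => /IH[t [sub_ts sz_t Ht]].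
by exists (v :: t); split; rewrite //= ?eqxx ?sz_t.
Qed.

End Boundary.

Lemma bd_map (T U : eqType) (R : comNzRingType) (f : U -> T) (H : seq T -> R) s :
  bd H (map f s) = bd (fun t => H (map f t)) s.
Proof. by elim: s H => [|v s IH] H //=; rewrite IH. Qed.

(** * Subdivision *)

Section Subdivision.
Variables (V C : eqType) (R : comNzRingType) (sg : seq V -> C).
Implicit Types (F : seq C -> R) (s : seq V).

(* The pairing of [F] with the barycentric subdivision of the simplex [s]: the sum,
   over the maximal flags of faces of [s] listed from the top down, of [F] at the
   labels [sg] of the flag. *)
Fixpoint sd k F s : R :=
  if k is k'.+1 then bd (sd k' (fun u => F (sg s :: u))) s else F [::].

Lemma sdB k F F' s : sd k (fun u => F u - F' u) s = sd k F s - sd k F' s.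
Proof.
elim: k F F' s => [|k IH] F F' s //=.
by rewrite -bdB; apply: eq_bd => t _ _; rewrite -IH.
Qed.

Lemma sd_sum (I : finType) k (F : I -> seq C -> R) s :
  sd k (fun u => \sum_i F i u) s = \sum_i sd k (F i) s.
Proof.
elim: k F s => [|k IH] F s //=.
by rewrite -bd_sum; apply: eq_bd => t _ _; rewrite -IH.
Qed.

Lemma eq_sd k F F' s : (forall u, size u = k -> F u = F' u) -> sd k F s = sd k F' s.
Proof.
elim: k F F' s => [|k IH] F F' s eqF /=; first exact: eqF.
by apply: eq_bd => t _ _; apply: IH => u szu; apply: eqF; rewrite /= szu.
Qed.

(** Subdivision is a chain map. Deleting the top label of a flag gives the right-hand side; by
    induction the other deletions contribute a [bd (bd _)], which vanishes. *)
Lemma sd_bd k F s : sd k.+1 (bd F) s = bd (sd k F) s.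
Proof.
elim: k F s => [|k IH] F s.
  by apply: eq_bd => t _ _ /=; rewrite subr0.
have -> : sd k.+2 (bd F) s = bd (fun t => sd k.+1 F t -
    sd k.+1 (bd (fun u => F (sg s :: u))) t) s.
  by apply: eq_bd => t _ _; rewrite -sdB.
rewrite bdB (_ : bd (sd k.+1 (bd _)) s = bd (bd (sd k (fun u => F (sg s :: u)))) s).
  by rewrite bd_bd subr0.
by apply: eq_bd => t _ _; apply: IH.
Qed.

Lemma sd_flag k F s : size s = k -> sd k F s != 0 ->
  exists f : seq (seq V), [/\ F (map sg f) != 0, map size f = rev (iota 1 k),
    sorted (fun a b => subseq b a) f & all (fun t => subseq t s) f].
Proof.
elim: k F s => [|k IH] F s szs; first by exists [::].
move=> /bd_neq0[t [sub_ts sz_t /IH[|f [Ff szf srt_f sub_f]]]].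
  by move: sz_t; rewrite szs => -[].
have sub_fs : all (fun t => subseq t s) f.
  by apply: sub_all sub_f => u sub_ut; apply: subseq_trans sub_ts.
exists (s :: f); split => //=.
- by have /(congr1 rev) := iotaD 1 k 1; rewrite rev_cat addn1 szf szs => /= ->.
- by rewrite path_min_sorted.
- by rewrite subseq_refl.
Qed.

End Subdivision.

(** * The Fan-type lemma for Z_p *)

Section Residues.
Variables (p : nat) (hp : prime p).
Local Notation K := 'F_p.

(** The carry when [h - g] is added to [g] on representatives below [p]. *)
Definition desc_ind (g h : K) : nat := (h < g)%N.

Lemma Fp_ltn (g : K) : (g < p)%N.
Proof. by rewrite -[X in (_ < X)%N](Fp_cast hp) ltn_ord. Qed.

Lemma Fp_valD (g h : K) : \val (g + h) = ((g + h) %% p)%N.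
Proof. by rewrite /= [X in (_ %% X)%N](Fp_cast hp). Qed.

Lemma desc_indE (g h : K) : (h + p * desc_ind g h = g + (h - g)%R)%N.
Proof.
rewrite -{1 2}(subrK g h) addrC /desc_ind; move: (h - g) => d.
have -> : nat_of_ord (g + d) = ((g + d) %% p)%N by exact: Fp_valD.
have := Fp_ltn g; have := Fp_ltn d.
move: (nat_of_ord d) (nat_of_ord g) => {g h}d a lt_d lt_a.
case: (ltnP (a + d) p) => [lt|le].
  by rewrite modn_small // ltnNge leq_addr muln0 addn0.
by rewrite -{1 2}(subnK le) modnDr modn_small; lia.
Qed.

(** In the sum of [desc_indE] over all translates the residues cancel, leaving [p] times the
    claim. *)
Lemma sum_desc_ind (g h : K) :
  (\sum_(t : K) desc_ind (g + t)%R (h + t)%R = (h - g)%R)%N.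
Proof.
have p0 := prime_gt0 hp.
have : (\sum_(t : K) ((h + t)%R + p * desc_ind (g + t)%R (h + t)%R) =
        \sum_(t : K) ((g + t)%R + (h - g)%R))%N.
  apply: eq_bigr => t _; rewrite desc_indE.
  by have -> : h + t - (g + t) = h - g by ring.
rewrite !big_split sum_nat_const card_Fp // -big_distrr.
have sum_shift (u : K) :
    (\sum_(t : K) nat_of_ord (u + t)%R = \sum_(t : K) nat_of_ord t)%N.
  by rewrite [RHS](reindex_inj (addrI u)).
rewrite !sum_shift => /addnI/eqP; rewrite eqn_pmul2l // => /eqP; exact.
Qed.

(* As [rho] is a primitive of the Bockstein cocycle, [rho_cycle_shift] says that
   the latter is invariant although [rho] is not. *)
Definition rho (g h : K) : K := (desc_ind g h)%:R.

Lemma rho_cycle_shift (t a b c : K) :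
  rho (b + t) (c + t) - rho (a + t) (c + t) + rho (a + t) (b + t) =
  rho b c - rho a c + rho a b.
Proof.
(* Over the integers, [p] times either alternating sum of carries is the residue of [c - b] minus
   that of [c - a] plus that of [b - a], and translation preserves differences. *)
suff E : (desc_ind (b + t)%R (c + t)%R + desc_ind (a + t)%R (b + t)%R + desc_ind a c =
   desc_ind b c + desc_ind a b + desc_ind (a + t)%R (c + t)%R)%N.
  apply/eqP; rewrite -subr_eq0; apply/eqP.
  move/(congr1 (fun m => m%:R : K)): E; rewrite !natrD -!/(rho _ _) => E.
  by rewrite -[RHS](subrr (rho b c + rho a b + rho (a + t) (c + t))) -{1}E; ring.
have shiftB (u v : K) : v + t - (u + t) = v - u by ring.
have := desc_indE a b; have := desc_indE b c; have := desc_indE a c.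
have := desc_indE (a + t) (b + t); have := desc_indE (b + t) (c + t).
have := desc_indE (a + t) (c + t); rewrite !shiftB.
have := prime_gt0 hp.
move: (nat_of_ord _) (nat_of_ord _) (nat_of_ord _) => x y z.
do 6! move: (nat_of_ord _).
do 6! move: (desc_ind _ _).
by move=> *; nia.
Qed.

Lemma sum_rho (g h : K) : \sum_(t : K) rho (g + t) (h + t) = h - g.
Proof. by rewrite -natr_sum sum_desc_ind natr_Zp. Qed.

Lemma rhoxx (g : K) : rho g g = 0.
Proof. by rewrite /rho /desc_ind ltnn. Qed.

(* The [i]-th cup power of the Bockstein cocycle, on sequences of size [2 i + 1]. *)
Fixpoint beta i (s : seq K) : K :=
  match i, s with
  | 0%N, _ => 1
  | i'.+1, a :: b :: ((c :: _) as t) =>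
      (rho b c - rho a c + rho a b) * beta i' t
  | _, _ => 0
  end.

(** Cup products with [beta i], of [rho] here and of the identity 0-cochain in [beta_mul]. They link
    the powers: [beta i.+1] is the coboundary of [beta_prim i], whose norm is the coboundary of
    [beta_mul i], whose difference under the shift by 1 is [beta i]. *)
Definition beta_prim i (s : seq K) : K :=
  if s is a :: ((b :: _) as t) then rho a b * beta i t else 0.

Definition beta_mul i (s : seq K) : K :=
  if s is a :: _ then a * beta i s else 0.

Lemma bd_beta_prim_of i s : size s = i.*2.+3 -> bd (beta i) (behead s) = 0 ->
  bd (beta_prim i) s = beta i.+1 s.
Proof.
case: s => [|a [|b [|c s]]] //= _.
move=> /eqP; rewrite subr_eq0 => /eqP E.
by rewrite /beta_prim !bdZ E; ring.
Qed.

(** A positive power is a coboundary by [bd_beta_prim_of], hence closed; that lemma needs the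
    preceding power closed, which is the induction hypothesis. *)
Lemma bd_beta i s : size s = i.*2.+2 -> bd (beta i) s = 0.
Proof.
elim: i s => [|i IH] s.
  by case: s => [|a [|b [|c s]]] //= _; ring.
move=> sz_s; rewrite -[RHS](bd_bd (beta_prim i) s).
apply: eq_bd => t _ sz_t; rewrite -bd_beta_prim_of ?IH ?size_behead //; lia.
Qed.

Lemma bd_beta_prim i s : size s = i.*2.+3 -> bd (beta_prim i) s = beta i.+1 s.
Proof.
by move=> sz_s; apply: bd_beta_prim_of => //; apply: bd_beta; rewrite size_behead sz_s.
Qed.

Lemma bd_beta_mul i a b s : size s = i.*2 ->
  bd (beta_mul i) (a :: b :: s) = (b - a) * beta i (b :: s).
Proof.
move=> sz_s; have := @bd_beta i (a :: b :: s); rewrite /= sz_s => /(_ erefl) /eqP.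
rewrite subr_eq0 => /eqP E.
by rewrite /beta_mul /= bdZ mulrBl E; ring.
Qed.

Lemma beta_shift i (g : K) s : beta i (map (+%R^~ g) s) = beta i s.
Proof.
elim: i s => [|i IH] // [|a [|b [|c s]]] //=.
by rewrite rho_cycle_shift -(IH (c :: s)).
Qed.

Lemma beta_mul_shift i s : size s = i.*2.+1 ->
  beta_mul i (map (+%R^~ 1) s) - beta_mul i s = beta i s.
Proof.
case: s => [|a s] // _; rewrite /beta_mul -[map _ _]/(map (+%R^~ 1) (a :: s)) beta_shift.
by rewrite /=; ring.
Qed.

Lemma sum_beta_prim_shift i s : size s = i.*2.+2 ->
  \sum_(g : K) beta_prim i (map (+%R^~ g) s) = bd (beta_mul i) s.
Proof.
case: s => [|a [|b s]] // [sz_s]; rewrite bd_beta_mul // -sum_rho mulr_suml.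
by apply: eq_bigr => g _; rewrite -(beta_shift i g (b :: s)).
Qed.

(** If [a = b] or [b = c], two [rho] terms of the leading factor cancel and the third has equal
    arguments, so the factor is zero. *)
Lemma beta_alt i s : size s = i.*2.+1 -> beta i s != 0 ->
  sorted (fun a b => a != b) s.
Proof.
elim: i s => [|i IH]; first by case=> [|a []].
case=> [|a [|b [|c s]]] // sz_s /=; rewrite mulf_eq0 negb_or => /andP[abc beta_c].
have sz_c : size (c :: s) = i.*2.+1 by move: sz_s => /=; lia.
have /= -> := IH _ sz_c beta_c; rewrite !andbT; apply/andP; split.
  by apply: contraNneq abc => ->; rewrite rhoxx; apply/eqP; ring.
by apply: contraNneq abc => ->; rewrite rhoxx; apply/eqP; ring.
Qed.

(** * Chains in the join of copies of Z_p *)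

Local Notation V := (nat * K)%type.
Implicit Types (H : seq V -> K).

Definition shift (g : K) (s : seq V) := map (fun v => (v.1, v.2 + g)) s.

Lemma shiftD g h s : shift g (shift h s) = shift (h + g) s.
Proof. by rewrite /shift -map_comp; apply: eq_map => v /=; rewrite addrA. Qed.

Lemma unzip1_shift g (s : seq V) : unzip1 (shift g s) = unzip1 s.
Proof. by rewrite /unzip1 -map_comp; apply: eq_map. Qed.

(* The two operators of the periodic resolution of Z_p, dualised. *)
Definition norm_or_diff (b : bool) (E : (seq V -> K) -> K) H :=
  if b then \sum_(g : K) E (fun t => H (shift g t))
  else E (fun t => H (shift 1 t)) - E H.

(* A chain of dimension [j] in the join is represented by its pairing with cochains;
   the vertex [(i, g)] is the value [g] in coordinate [i]. *)
Fixpoint chain j H : K :=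
  if j is i.+1 then norm_or_diff (odd i) (chain i) (fun t => H ((i.+1, 0) :: t))
  else H [:: (0%N, 0)].

Lemma eq_norm_or_diff b E E' H H' :
  (forall g, E (fun t => H (shift g t)) = E' (fun t => H' (shift g t))) ->
  E H = E' H' -> norm_or_diff b E H = norm_or_diff b E' H'.
Proof. by case: b => eqE E0; rewrite /= ?E0 ?eqE //; apply: eq_bigr. Qed.

Lemma eq_chain j H H' : (forall s, unzip1 s = rev (iota 0 j.+1) -> H s = H' s) ->
  chain j H = chain j H'.
Proof.
elim: j H H' => [|j IH] H H' eqH /=; first exact: eqH.
have revS : rev (iota 0 j.+2) = j.+1 :: rev (iota 0 j.+1).
  by have /(congr1 rev) := iotaD 0 j.+1 1; rewrite rev_cat addn1 => ->.
apply: eq_norm_or_diff => [g|]; apply: IH => s Es; apply: eqH.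
  by rewrite /= unzip1_shift Es revS.
by rewrite /= Es revS.
Qed.

Lemma eqf_chain j H H' : H =1 H' -> chain j H = chain j H'.
Proof. by move=> eqH; apply: eq_chain => s _. Qed.

Lemma chainB j H H' : chain j (fun t => H t - H' t) = chain j H - chain j H'.
Proof.
elim: j H H' => [|j IH] H H' //=; rewrite /norm_or_diff; case: odd; last first.
  by rewrite !IH; ring.
by under eq_bigr do rewrite IH; rewrite sumrB.
Qed.

Lemma chain_sum (I : finType) j (H : I -> seq V -> K) :
  chain j (fun t => \sum_i H i t) = \sum_i chain j (H i).
Proof.
elim: j H => [|j IH] H //=; rewrite /norm_or_diff; case: odd; last first.
  rewrite (IH (fun i t => H i ((j.+1, 0) :: shift 1 t))).
  by rewrite (IH (fun i t => H i ((j.+1, 0) :: t))) sumrB.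
rewrite exchange_big; apply: eq_bigr => g _.
exact: (IH (fun i t => H i ((j.+1, 0) :: shift g t))).
Qed.

(** Each chain is a cone with apex [(j.+1, 0)] over a cycle, so its boundary is that cycle. The base
    is a cycle because norm and difference compose to zero: adding 1 permutes the shifts. *)
Lemma chain_bd j H : chain j.+1 (bd H) = norm_or_diff (odd j) (chain j) H.
Proof.
have bd_rec i H' :
    norm_or_diff (odd i) (chain i) (bd (fun t => H' ((i.+1, 0) :: t))) = 0 ->
    chain i.+1 (bd H') = norm_or_diff (odd i) (chain i) H'.
  move=> E0; rewrite -[RHS]subr0 -E0 /= /norm_or_diff.
  case: odd; last by rewrite !chainB; ring.
  by rewrite -sumrB; apply: eq_bigr => g _; rewrite chainB.
apply: (bd_rec); move: (fun t => H _) => {}H.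
elim: j H => [|j IH] H; first by rewrite /= /norm_or_diff /= !subr0 subrr.
have chain_bd H' := bd_rec j H' (IH _).
rewrite (@eq_norm_or_diff _ _ (norm_or_diff (odd j) (chain j)) _ H) //; last first.
  move=> g; rewrite -chain_bd; apply: eqf_chain => t.
  by rewrite /shift bd_map.
rewrite /norm_or_diff /=; case: odd => /=; last first.
  rewrite sumrB; apply/eqP; rewrite subr_eq0; apply/eqP.
  rewrite [RHS](reindex_inj (addIr 1)); apply: eq_bigr => g _.
  by apply: eqf_chain => t; rewrite shiftD addrC.
apply/eqP; rewrite subr_eq0; apply/eqP.
rewrite [RHS](reindex_inj (addIr 1)); apply: eq_bigr => g _.
by apply: eqf_chain => t; rewrite shiftD.
Qed.

(** * Pairing with an equivariant labelling *)

Variable sg : seq V -> K.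
Hypothesis sg_shift : forall g s, s != [::] -> sg (shift g s) = sg s + g.

Lemma sd_shift k (F : seq K -> K) g s : size s = k ->
  sd sg k F (shift g s) = sd sg k (fun u => F (map (+%R^~ g) u)) s.
Proof.
elim: k F s => [|k IH] F s sz_s //=.
rewrite sg_shift; last by rewrite -size_eq0 sz_s.
rewrite bd_map; apply: eq_bd => t _ sz_t.
by apply: IH; move: sz_t; rewrite sz_s => -[].
Qed.

Lemma unzip1_size (s : seq V) j : unzip1 s = rev (iota 0 j) -> size s = j.
Proof. by move/(congr1 size); rewrite size_map size_rev size_iota. Qed.

(** Two dimensions are descended per step: the coboundary of [beta_prim] moves to the chain and
    becomes a norm, which turns [beta_prim] into the coboundary of [beta_mul]; that one becomes a
    difference, which turns [beta_mul] into [beta i]. *)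
Lemma chain_beta i : chain i.*2 (sd sg i.*2.+1 (beta i)) = 1.
Proof.
elim: i => [|i IH]; first by rewrite /= subr0.
rewrite -[RHS]IH doubleS.
transitivity (chain i.*2.+2 (bd (sd sg i.*2.+2 (beta_prim i)))).
  apply: eqf_chain => s; rewrite -sd_bd; apply: eq_sd => u sz_u.
  by rewrite bd_beta_prim.
rewrite chain_bd oddS odd_double /norm_or_diff.
rewrite -(chain_sum _ (fun g t => sd sg i.*2.+2 (beta_prim i) (shift g t))).
transitivity (chain i.*2.+1 (bd (sd sg i.*2.+1 (beta_mul i)))).
  apply: eq_chain => s /unzip1_size sz_s; rewrite -sd_bd.
  under eq_bigr do rewrite sd_shift //.
  by rewrite -sd_sum; apply: eq_sd => u; apply: sum_beta_prim_shift.
rewrite chain_bd odd_double /norm_or_diff -chainB.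
apply: eq_chain => s /unzip1_size sz_s; rewrite sd_shift // -sdB.
by apply: eq_sd => u; apply: beta_mul_shift.
Qed.

Lemma alternating_flag i : exists f : seq (seq V),
  [/\ map size f = rev (iota 1 i.*2.+1),
      sorted (fun a b => subseq b a) f, sorted (fun a b => sg a != sg b) f &
      forall t, t \in f -> subseq (unzip1 t) (rev (iota 0 i.*2.+1))].
Proof.
have [[s Es]|none] := classic (exists2 s, unzip1 s = rev (iota 0 i.*2.+1) &
    sd sg i.*2.+1 (beta i) s != 0); last first.
  (* If every pairing vanished, [chain_beta] would give 0 = 1. The zero cochain is written [1 - 1]
     so that [chainB] evaluates it. *)
  have := chain_beta i; rewrite (@eq_chain _ _ (fun=> 1 - 1)).
    by rewrite chainB subrr => /esym/eqP; rewrite oner_eq0.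
  move=> s Es; rewrite subrr; apply/eqP/negPn/negP => nz.
  by apply: none; exists s.
move/sd_flag => /(_ (unzip1_size Es))[f [beta_f sz_f srt_f sub_f]].
exists f; split => //.
  have sz_sgf : size (map sg f) = i.*2.+1.
    by rewrite size_map -(size_map size f) sz_f size_rev size_iota.
  by have := beta_alt sz_sgf beta_f; rewrite sorted_map.
by move=> t /(allP sub_f)/(map_subseq fst); rewrite -Es.
Qed.

End Residues.

(** * Labels from a colouring *)

Section Colouring.
Variables (p : nat) (hp : prime p) (n k al : nat) (f : 'rV['F_p]_n -> 'I_k).
Local Notation K := 'F_p.
Local Notation V := (nat * K)%type.

(** The radius is the largest number of coordinates left free by a face with more than [al]
    vertices. *)
Hypothesis f_proper : forall y y' : 'rV[K]_n, y != y' ->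
  (hamming (y' - y)%R (const_mx (GRing.one K)) <= n - al.+1)%N -> f y != f y'.

Definition compat (s : seq V) (y : 'rV[K]_n) :=
  all (fun v => [forall i : 'I_n, (i == v.1 :> nat) ==> (y ord0 i == v.2)]) s.

Definition maxcol s : nat := \max_(y | compat s y) f y.

Definition maxcol_orbit s : nat := \max_(g : K) maxcol (shift (- g) s).

Definition top_shifts s : {set K} := [set g | maxcol (shift (- g) s) == maxcol_orbit s].

(* The mean is equivariant because [#|top_shifts s|] is invertible modulo [p]. *)
Definition colour_sign s : K :=
  if (al < size s)%N && (top_shifts s != setT)
  then (\sum_(t in top_shifts s) t) / #|top_shifts s|%:R else (head (0%N, 0) s).2.

Lemma maxcol_orbit_shift h s : maxcol_orbit (shift h s) = maxcol_orbit s.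
Proof.
rewrite /maxcol_orbit (reindex_inj (addIr h)); apply: eq_bigr => g _ /=.
by rewrite shiftD opprD addrC subrK.
Qed.

Lemma top_shifts_shift h s : top_shifts (shift h s) = [set g + h | g in top_shifts s].
Proof.
apply/setP => g; apply/idP/imsetP => [gT|[t tT ->]].
  exists (g - h); rewrite ?subrK //; move: gT.
  by rewrite !inE maxcol_orbit_shift shiftD opprB.
by move: tT; rewrite !inE maxcol_orbit_shift shiftD opprD addrCA subrr addr0.
Qed.

Lemma top_shifts_gt0 s : (0 < #|top_shifts s|)%N.
Proof.
apply/card_gt0P.
have [|g Eg] := @bigop.eq_bigmax K (fun g => maxcol (shift (- g) s)).
  by apply/card_gt0P; exists 0.
by exists g; rewrite inE /maxcol_orbit Eg.
Qed.

Lemma card_top_shifts_lt s : top_shifts s != setT -> (#|top_shifts s| < p)%N.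
Proof.
by rewrite -properT => /proper_card; rewrite cardsT card_Fp.
Qed.

Lemma colour_sign_shift g s : s != [::] -> colour_sign (shift g s) = colour_sign s + g.
Proof.
move=> s0; rewrite /colour_sign size_map top_shifts_shift card_imset; last exact: addIr.
have -> : ([set t + g | t in top_shifts s] != setT) = (top_shifts s != setT).
  by rewrite !eqEcard !subsetT /= card_imset //; exact: addIr.
case: ifP => [/andP[_ /card_top_shifts_lt ltp]|_]; last by case: s s0.
rewrite big_imset /=; last by move=> ? ? _ _; exact: addIr.
rewrite big_split /= sumr_const mulrDl; congr (_ + _).
rewrite -[g *+ _]mulr_natr mulfK // -(dvdn_pcharf (pchar_Fp hp)).
by rewrite gtnNdvd // top_shifts_gt0.
Qed.

Definition good (s : seq V) := [&& uniq (unzip1 s), all (gtn n) (unzip1 s) & al < size s]%N.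

Lemma compat_exists s : uniq (unzip1 s) -> exists y, compat s y.
Proof.
move=> us; exists (\row_i nth 0 (unzip2 s) (index (val i) (unzip1 s))).
apply/allP => v vs; apply/forallP => i; apply/implyP => /eqP Ei; rewrite mxE /= Ei.
move: vs; case/(nthP (0%N, 0)) => j ltj <-.
rewrite -(nth_map _ 0%N fst) // index_uniq ?size_map //.
by rewrite (nth_map (0%N, 0)).
Qed.

Lemma maxcol_attained s : uniq (unzip1 s) -> exists2 y, compat s y & maxcol s = f y.
Proof.
move=> /compat_exists[y0 cy0].
have [|y cy E] := @bigop.eq_bigmax_cond _ (mem (compat s)) (fun y => nat_of_ord (f y)).
  by apply/card_gt0P; exists y0.
by exists y.
Qed.

Lemma size_le_coords (l : seq nat) : uniq l -> all (gtn n) l ->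
  (size l <= #|[set i : 'I_n | val i \in l]|)%N.
Proof.
move=> ul ltl; rewrite cardE -(size_map val); apply: uniq_leq_size => // x xl.
have ltx : (x < n)%N by move/allP: ltl => /(_ x xl).
by apply/mapP; exists (Ordinal ltx) => //; rewrite mem_enum inE.
Qed.

(** On the coordinates fixed by [s] the difference [y' - y] is 1, so only the free ones count. *)
Lemma hamming_compat s y y' : good s -> compat s y -> compat (shift 1 s) y' ->
  (hamming (y' - y)%R (const_mx (GRing.one K)) <= n - al.+1)%N.
Proof.
case/and3P=> us ls sz_s cy cy'.
have := size_le_coords us ls; rewrite size_map => le_s.
have le1 : (hamming (y' - y)%R (const_mx (GRing.one K)) <=
            #|~: [set i : 'I_n | val i \in unzip1 s]|)%N.
  apply: subset_leq_card; apply/subsetP => i; rewrite !inE; apply: contra.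
  case/mapP => v vs Ei; rewrite !mxE.
  have /forallP/(_ i) := allP cy v vs; rewrite Ei eqxx => /eqP ->.
  have vs' : (v.1, v.2 + 1) \in shift 1 s by apply: (map_f (fun v => (v.1, v.2 + 1))).
  have /forallP/(_ i) := allP cy' _ vs'; rewrite /= Ei eqxx => /eqP ->.
  by rewrite addrAC subrr add0r.
apply: leq_trans le1 _; rewrite cardsCs setCK card_ord leq_sub2l //.
exact: leq_trans le_s.
Qed.

Lemma good_top_shifts s : good s -> top_shifts s != setT.
Proof.
move=> gs; apply/eqP => TT.
have mcE g : maxcol (shift g s) = maxcol_orbit s.
  have : - g \in top_shifts s by rewrite TT inE.
  by rewrite inE opprK => /eqP.
have [us ls sz_s] := and3P gs.
have [y cy fy] := maxcol_attained us.
have us1 : uniq (unzip1 (shift 1 s)) by rewrite unzip1_shift.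
have [y' cy' fy'] := maxcol_attained us1.
have eqf : f y = f y'.
  apply/val_inj => /=; rewrite -fy -fy' mcE -(mcE 0); congr maxcol.
  by rewrite -[LHS]map_id; apply: eq_map => -[a b] /=; rewrite addr0.
suff : f y != f y' by rewrite eqf eqxx.
apply: f_proper; last exact: hamming_compat cy cy'.
(* A common completion would take both values [v.2] and [v.2 + 1] at the coordinate of the first
   vertex [v]. *)
apply/eqP => Ey; move: cy cy'; rewrite -Ey.
case: s {TT mcE gs us fy us1 fy' eqf} ls sz_s => [|v s] //= /andP[ltv _] _.
move=> /andP[/forallP/(_ (Ordinal ltv)) /=]; rewrite eqxx => /eqP E0 _.
move=> /andP[/forallP/(_ (Ordinal ltv)) /=]; rewrite eqxx E0 => /eqP E _.
by move: E; rewrite -{1}[v.2]addr0 => /addrI/esym/eqP; rewrite oner_eq0.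
Qed.

(** The lexicographic pair written in base [p.-1]; on good faces [top_shifts] is nonempty and
    proper, so its size less one is a digit. *)
Definition level s : nat := (maxcol_orbit s * p.-1 + #|top_shifts s|.-1)%N.

Lemma pred_top_shifts_lt s : good s -> (#|top_shifts s|.-1 < p.-1)%N.
Proof.
move=> /good_top_shifts/card_top_shifts_lt; have := top_shifts_gt0 s.
by case: #|_| => // m _; case: p.
Qed.

(** A smaller face has more completions, so all maxima weakly increase. If the overall maximum
    stays, [top_shifts] can only grow, and were it unchanged the labels would agree. *)
Lemma level_lt a b : good a -> good b -> subseq b a ->
  colour_sign a != colour_sign b -> (level a < level b)%N.
Proof.
move=> ga gb sub_ba neq_sg.
have le_mc g : (maxcol (shift g a) <= maxcol (shift g b))%N.
  apply/bigmax_leqP => y ca; apply: leq_bigmax_cond.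
  apply/allP => v vb; apply: (allP ca); apply: mem_subseq vb.
  exact: map_subseq.
have leM : (maxcol_orbit a <= maxcol_orbit b)%N.
  apply/bigmax_leqP => g _; apply: leq_trans (le_mc _) _.
  exact: (leq_bigmax (F := fun g => maxcol (shift (- g) b))).
have lta := pred_top_shifts_lt ga.
move: leM; rewrite leq_eqVlt => /orP[/eqP eqM|ltM]; last first.
  apply: (@leq_trans ((maxcol_orbit a).+1 * p.-1)).
    by rewrite /level mulSn addnC ltn_add2r.
  by apply: leq_trans (leq_addr _ _); rewrite leq_mul2r ltM orbT.
have subT : top_shifts a \subset top_shifts b.
  apply/subsetP => g; rewrite !inE => /eqP Eg; rewrite eqn_leq; apply/andP; split.
    exact: (leq_bigmax (F := fun g => maxcol (shift (- g) b))).
  by rewrite -eqM -Eg le_mc.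
have ltT : (#|top_shifts a| < #|top_shifts b|)%N.
  rewrite ltnNge; apply: contra neq_sg => leT.
  have eqT : top_shifts a = top_shifts b by apply/eqP; rewrite eqEcard subT.
  have [_ _ sa] := and3P ga; have [_ _ sb] := and3P gb.
  by rewrite /colour_sign sa sb eqT good_top_shifts.
rewrite /level eqM ltn_add2l; move: ltT (top_shifts_gt0 a).
by case: #|_| #|_| => [|u] [|v].
Qed.

Lemma flag_length_le i : (i.*2.+1 <= n)%N -> (i.*2.+1 - al <= k * p.-1)%N.
Proof.
move=> le_n; set N := i.*2.+1.
have [le_Nal|lt_alN] := leqP N al; first by rewrite (eqP le_Nal).
have [F [sz_F sub_F sg_F unz_F]] := alternating_flag hp colour_sign_shift i.
(* The flag lists faces of sizes [N] down to 1, so these are the ones with more than [al]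
   vertices. *)
set G := take (N - al) F.
have szG : size G = (N - al)%N.
  rewrite size_take -(size_map size F) sz_F size_rev size_iota -/N.
  by case: ltnP => //; lia.
have goodG : all good G.
  apply/allP => t tG; have tF := mem_take tG.
  have subt := unz_F t tF; apply/and3P; split.
  - by apply: subseq_uniq subt _; rewrite rev_uniq iota_uniq.
  - apply/allP => x /(mem_subseq subt); rewrite mem_rev mem_iota /= => ltx.
    exact: leq_trans ltx le_n.
  - have : size t \in map size G by apply: map_f.
    rewrite /G map_take sz_F take_rev size_iota -/N subKn ?(ltnW lt_alN) //.
    by rewrite drop_iota mem_rev mem_iota => /andP[].
have srt : sorted ltn (map level G).
  rewrite sorted_map.
  apply: (@sub_in_sorted _ (mem good)
    [rel a b | subseq b a && (colour_sign a != colour_sign b)]).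
  - by move=> a b ga gb /= /andP[]; apply: level_lt.
  - exact: goodG.
  - by rewrite sorted_relI !take_sorted.
rewrite -szG -(size_map level) -[X in (_ <= X)%N](size_iota 0).
apply: uniq_leq_size; first by apply: sorted_uniq srt; [exact: ltn_trans | exact: ltnn].
move=> _ /mapP[t tG ->]; rewrite mem_iota add0n /=.
have gt := allP goodG t tG.
have ltk : (maxcol_orbit t < k)%N.
  have [|g Eg] := @bigop.eq_bigmax K (fun g => maxcol (shift (- g) t)).
    by apply/card_gt0P; exists 0.
  rewrite /maxcol_orbit Eg.
  have ug : uniq (unzip1 (shift (- g) t)) by rewrite unzip1_shift; case/and3P: gt.
  by have [y _ ->] := maxcol_attained ug.
apply: (@leq_trans ((maxcol_orbit t).+1 * p.-1)).
  by rewrite /level mulSn addnC ltn_add2r pred_top_shifts_lt.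
by rewrite leq_mul2r ltk orbT.
Qed.

End Colouring.

(** * Falling factorials against powers *)

Lemma ffact_leX m L : (m ^_ L <= m ^ L)%N.
Proof.
elim: L => [|L IH]; first by rewrite ffactn0 expn0.
by rewrite ffactnSr expnSr leq_mul // leq_subr.
Qed.

Lemma leX_ffact b L : (b ^ L <= (b + L) ^_ L)%N.
Proof.
elim: L => [|L IH]; first by rewrite ffactn0 expn0.
by rewrite addnS ffactSS expnS leq_mul //; lia.
Qed.

(** * Dense independent set *)

Section Counting.
Variables (p : nat) (hp : prime p) (n : nat).
Local Notation K := 'F_p.
Local Notation X := 'rV[K]_n.
Implicit Types (x y : X) (a : K) (J : {set 'I_n}).

Definition fibre a x : {set 'I_n} := [set i | x ord0 i == a].
Definition cnt a x : nat := #|fibre a x|.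

Local Arguments cnt a%_R x.

(** The indicator of [g == a] minus its mean, scaled by [p] to stay integral. *)
Definition centred a (g : K) : int := (if g == a then p%:R else 0) - 1.

Lemma sum_centred a : \sum_g centred a g = 0.
Proof.
rewrite /centred sumrB -big_mkcond big_pred1_eq sumr_const card_Fp //.
by rewrite subrr.
Qed.

Lemma sum_centred_coord a x : \sum_(i < n) centred a (x ord0 i) = (p * cnt a x)%:Z - n%:Z.
Proof.
rewrite /centred sumrB -big_mkcond !sumr_const card_ord; congr (_ - _).
  rewrite /cnt /fibre PoszM cardsE.
  by rewrite -[_ *+ #|_|]mulr_natr !natz.
by rewrite natz.
Qed.

(** Translating coordinate [i] preserves the sum, and averaging over the translations produces the
    factor [sum_centred]. *)
Lemma centred_orthogonal a (i j : 'I_n) : i != j ->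
  \sum_(x : X) centred a (x ord0 i) * centred a (x ord0 j) = 0.
Proof.
move=> neq_ij; set S := \sum_x _.
have ES (t : K) : S = \sum_(x : X) centred a (x ord0 i + t) * centred a (x ord0 j).
  rewrite /S (reindex_inj (addIr (t *: delta_mx ord0 i))); apply: eq_bigr => x _.
  by rewrite !mxE !eqxx (eq_sym j) (negbTE neq_ij) mulr1 mulr0 addr0.
have : \sum_(t : K) S = 0.
  rewrite (eq_bigr _ (fun t _ => ES t)).
  rewrite exchange_big big1 // => x _; rewrite -mulr_suml.
  have <- := reindex_inj (addrI (x ord0 i)) (F := centred a) (P := xpredT).
  by rewrite sum_centred mul0r.
rewrite sumr_const card_Fp // => /eqP; rewrite mulrn_eq0.
by rewrite -leqn0 leqNgt prime_gt0 //= => /eqP.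
Qed.

Lemma centred_sqr_le a g : centred a g ^+ 2 <= (p ^ 2)%:Z.
Proof.
have := prime_gt1 hp; rewrite /centred natz -mulnn PoszM.
by case: eqP => _ lt1p; rewrite expr2; nia.
Qed.

Lemma cnt_variance a :
  \sum_(x : X) ((p * cnt a x)%:Z - n%:Z) ^+ 2 <= (n * p ^ 2 * p ^ n)%:Z.
Proof.
have -> : \sum_(x : X) ((p * cnt a x)%:Z - n%:Z) ^+ 2 =
    \sum_(i < n) \sum_(x : X) centred a (x ord0 i) ^+ 2.
  transitivity (\sum_(x : X) \sum_(i < n) \sum_(j < n)
      centred a (x ord0 i) * centred a (x ord0 j)).
    by apply: eq_bigr => x _; rewrite -sum_centred_coord expr2 big_distrlr.
  rewrite exchange_big; apply: eq_bigr => i _; rewrite exchange_big (bigD1 i) //=.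
  rewrite [X in _ + X]big1 ?addr0; first by apply: eq_bigr => x _; rewrite expr2.
  by move=> j ji; rewrite centred_orthogonal // eq_sym.
apply: (@le_trans _ _ (\sum_(i < n) \sum_(x : X) (p ^ 2)%:Z)).
  by apply: ler_sum => i _; apply: ler_sum => x _; apply: centred_sqr_le.
rewrite !sumr_const card_ord card_mx card_Fp // mul1n -!mulrnA -mulr_natr natz.
by rewrite -PoszM; lia.
Qed.

Definition deviant (r : nat) a : {set X} :=
  [set x | (n + 2 * p * r <= p * cnt a x)%N || (p * cnt a x + 2 * p * r <= n)%N].

Local Arguments deviant r a%_R.

(** Chebyshev: [p * cnt a x] has variance at most [n * p ^ 2], and the squared threshold is at least
    four times that. A quarter for each of two values leaves half of the vectors typical. *)
Lemma card_deviant r a : (0 < r)%N -> (n <= r ^ 2)%N -> (4 * #|deviant r a| <= p ^ n)%N.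
Proof.
move=> r0 le_nr.
have : (#|deviant r a| * (2 * p * r) ^ 2)%:Z <= (n * p ^ 2 * p ^ n)%:Z.
  apply: le_trans (cnt_variance a); rewrite PoszM -natz mulr_natl -sumr_const.
  rewrite [X in _ <= X](bigID (mem (deviant r a))) /= ler_wpDr //.
    by apply: sumr_ge0 => x _; apply: sqr_ge0.
  apply: ler_sum => x; rewrite inE -mulnn PoszM expr2.
  move: (cnt a x) (2 * p * r)%N => c d; move: (p * c)%N => {}c; nia.
rewrite lez_nat => le1.
have p0 := prime_gt0 hp.
rewrite -(@leq_pmul2l (p ^ 2 * r ^ 2)) ?muln_gt0 ?expn_gt0 ?p0 ?r0 //.
have -> : (p ^ 2 * r ^ 2 * (4 * #|deviant r a|) = #|deviant r a| * (2 * p * r) ^ 2)%N.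
  by rewrite !expnMn; lia.
apply: leq_trans le1 _; rewrite [(p ^ 2 * _)%N]mulnC.
by rewrite leq_mul2r leq_mul2r le_nr !orbT.
Qed.

Lemma card_typical r : (0 < r)%N -> (n <= r ^ 2)%N ->
  (p ^ n <= 2 * #|~: (deviant r 0 :|: deviant r 1)|)%N.
Proof.
move=> r0 le_nr.
have := card_deviant 0 r0 le_nr; have := card_deviant 1 r0 le_nr.
have := cardsC (deviant r 0 :|: deviant r 1); rewrite card_mx card_Fp // mul1n.
have [leU _] := leq_card_setU (deviant r 0) (deviant r 1); move: leU.
by move: #|_ :|: _| #|~: _| #|deviant r 0| #|deviant r 1| => u v a b; lia.
Qed.

(** * Turning ones into zeros *)

Definition recolour x J : X := \row_i (if i \in J then 0 else x ord0 i).

Lemma cnt0_recolour x J : J \subset fibre 1 x -> cnt 0 (recolour x J) = (cnt 0 x + #|J|)%N.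
Proof.
move=> sJ; rewrite /cnt.
have -> : fibre 0 (recolour x J) = fibre 0 x :|: J.
  by apply/setP => i; rewrite !inE mxE; case: (i \in J); rewrite ?eqxx ?orbT ?orbF.
rewrite cardsU; have -> : fibre 0 x :&: J = set0; last by rewrite cards0 subn0.
apply/setP => i; rewrite !inE; apply/negP => /andP[/eqP xi0 /(subsetP sJ)].
by rewrite inE xi0 eq_sym oner_eq0.
Qed.

Lemma cnt1_recolour x J : J \subset fibre 1 x -> (cnt 1 (recolour x J) + #|J| = cnt 1 x)%N.
Proof.
move=> sJ; rewrite /cnt -(cardsID J (fibre 1 x)) addnC; congr (_ + _)%N.
  by rewrite (setIidPr sJ).
congr #|pred_of_set _|; apply/setP => i; rewrite !inE mxE.
by case: (i \in J) => //=; rewrite eq_sym oner_eq0.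
Qed.

Lemma recolourK x J : J \subset fibre 1 x ->
  \row_i (if i \in J then 1 else recolour x J ord0 i) = x.
Proof.
move=> sJ; apply/rowP => i; rewrite !mxE; case: (boolP (i \in J)) => // /(subsetP sJ).
by rewrite inE => /eqP ->.
Qed.

Lemma card_pairs (W : {set X}) (B : X -> {set 'I_n}) L :
  #|[set u : X * {set 'I_n} | [&& u.1 \in W, u.2 \subset B u.1 & #|u.2| == L]]| =
  (\sum_(x in W) 'C(#|B x|, L))%N.
Proof.
under eq_bigr => x _ do rewrite -cards_draws -sum1dep_card.
by rewrite pair_big_dep -sum1dep_card; apply: eq_bigl => -[x J].
Qed.

(** Double counting of pairs: [(x, J)] goes to [(recolour x J, J)], injectively since resetting [J]
    to ones restores [x], and [J] lies among the zeros of the image. *)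
Lemma recolour_count (W A : {set X}) L m M :
  (forall x, x \in W -> (m <= cnt 1 x)%N) -> (forall y, y \in A -> (cnt 0 y <= M)%N) ->
  (forall x J, x \in W -> J \subset fibre 1 x -> #|J| = L -> recolour x J \in A) ->
  (#|W| * 'C(m, L) <= #|A| * 'C(M, L))%N.
Proof.
move=> leW leA WA.
apply: (@leq_trans (\sum_(x in W) 'C(cnt 1 x, L))).
  by rewrite -sum_nat_const; apply: leq_sum => x xW; apply/leq_bin2l/leW.
apply: (@leq_trans (\sum_(y in A) 'C(cnt 0 y, L))); last first.
  by rewrite -sum_nat_const; apply: leq_sum => y yA; apply/leq_bin2l/leA.
rewrite -!card_pairs.
rewrite -(@card_in_imset _ _ (fun u : X * {set 'I_n} => (recolour u.1 u.2, u.2))).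
  apply: subset_leq_card; apply/subsetP => u /imsetP[[x J]]; rewrite inE /=.
  case/and3P => xW sJ /eqP cJ ->; rewrite inE /= cJ eqxx andbT WA //=.
  by apply/subsetP => i iJ; rewrite inE mxE iJ.
move=> [x J] [x' J']; rewrite !inE /= => /and3P[_ sJ _] /and3P[_ sJ' _] EE.
have /= E := congr1 fst EE; have /= EJ := congr1 snd EE.
by rewrite -EJ in sJ' E *; rewrite -(recolourK sJ) -(recolourK sJ') E.
Qed.

Lemma cnt_shift_le x y : (cnt 0 x <= cnt 1 y + hamming (y - x)%R (const_mx (GRing.one K)))%N.
Proof.
apply: leq_trans (leq_card_setU _ _); apply: subset_leq_card.
apply/subsetP => i; rewrite !inE !mxE => /eqP ->; rewrite subr0.
by case: eqP.
Qed.

(** The first two conditions give independence; the third bounds the number of choices backwards. *)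
Definition skewed (r : nat) : {set X} :=
  [set y | [&& n + p ^ 2 * r < p * cnt 0 y, p * cnt 1 y <= n
             & cnt 0 y <= n %/ p + 1 + (p + 6) * r]%N].

Lemma skewed_far r x y : x \in skewed r -> y \in skewed r ->
  (p * r < hamming (y - x)%R (const_mx (GRing.one K)))%N.
Proof.
rewrite !inE => /and3P[lt0 _ _] /and3P[_ le1 _].
have := cnt_shift_le x y; have := prime_gt0 hp.
move: (cnt 0 x) (cnt 1 y) (hamming _ _) lt0 le1 => a b h; nia.
Qed.

Lemma card_skewed r : (0 < r)%N -> (n <= r ^ 2)%N -> ((p + 6) * r <= n %/ p)%N ->
  (p ^ n * (n %/ p - (p + 6) * r) ^ ((p + 4) * r) <=
   2 * #|skewed r| * (n %/ p + 1 + (p + 6) * r) ^ ((p + 4) * r))%N.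
Proof.
move=> r0 le_nr le_rn; set b := (_ - _)%N; set M := (_ + _ + _)%N; set L := ((p + 4) * r)%N.
have p0 := prime_gt0 hp.
have dn := divn_eq n p; have mn := ltn_pmod n p0.
set W := ~: (deviant r 0 :|: deviant r 1).
have key : (#|W| * 'C(b + L, L) <= #|skewed r| * 'C(M, L))%N.
  apply: recolour_count => [x|y|x J].
  - rewrite !inE !negb_or -!ltnNge => /andP[_ /andP[_]]; rewrite /b /L.
    move: (cnt 1 x) (n %/ p)%N (n %% p)%N dn mn le_rn => c u v; nia.
  - by rewrite inE => /and3P[].
  rewrite !inE !negb_or -!ltnNge => /andP[/andP[h1 h2] /andP[h3 h4]] sJ cJ.
  rewrite cnt0_recolour // cJ; have := cnt1_recolour sJ; rewrite cJ.
  move: (cnt 1 _) (cnt 1 x) (cnt 0 x) h1 h2 h3 h4 => c1' c1 c0 h1 h2 h3 h4 E.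
  rewrite /L in E *.
  move: (n %/ p)%N (n %% p)%N dn mn le_rn => u v dn mn le_rn.
  by apply/and3P; split; nia.
have Lb : (#|W| * b ^ L <= #|skewed r| * M ^ L)%N.
  apply: (@leq_trans (#|W| * ('C(b + L, L) * L`!))).
    by rewrite bin_ffact leq_mul2l leX_ffact orbT.
  rewrite mulnA; apply: leq_trans (_ : #|skewed r| * ('C(M, L) * L`!) <= _)%N.
    by rewrite mulnA leq_mul2r key orbT.
  by rewrite bin_ffact leq_mul2l ffact_leX orbT.
apply: (@leq_trans (2 * #|W| * b ^ L)).
  by rewrite leq_mul2r card_typical ?orbT.
by rewrite -!mulnA leq_mul2l.
Qed.

End Counting.

(* The two bounds over the reals *)
Close Scope ring_scope.
From Stdlib Require Import Reals Lra.

Lemma INR_expn m k : INR (expn m k) = (INR m ^ k)%R.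
Proof. by elim: k => [|k IH] //; rewrite expnS mult_INR IH. Qed.

Lemma INR_leq m k : (m <= k)%N -> (INR m <= INR k)%R.
Proof. by move=> le; apply/le_INR/ssrnat.leP. Qed.

Lemma INR_leqP m k : (INR m <= INR k)%R -> (m <= k)%N.
Proof. by move=> /INR_le/ssrnat.leP. Qed.

Lemma sqrt_INR_le m k : (m <= k * k)%N -> (sqrt (INR m) <= INR k)%R.
Proof.
move=> /INR_leq; rewrite mult_INR => le.
by rewrite -(sqrt_square (INR k)); [apply: sqrt_le_1_alt | apply: pos_INR].
Qed.

Lemma INR_le_sqrt m k : (k * k <= m)%N -> (INR k <= sqrt (INR m))%R.
Proof.
move=> /INR_leq; rewrite mult_INR => le.
by rewrite -(sqrt_square (INR k)); [apply: sqrt_le_1_alt | apply: pos_INR].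
Qed.

Lemma exp_pow x k : (exp x ^ k = exp (x * INR k))%R.
Proof.
elim: k => [|k IH]; first by rewrite Rmult_0_r exp_0.
by rewrite S_INR Rmult_plus_distr_l Rmult_1_r exp_plus -IH Rmult_comm.
Qed.

Lemma S_ballE p n (x : 'rV['F_p]_n) : x \in @S_ball p n <->
  (INR (hamming x (const_mx (GRing.one 'F_p))) <= INR p * sqrt (INR n))%R.
Proof. by rewrite unfold_in; case: Rle_dec. Qed.

Lemma nat_sqrt n : exists q, (q * q <= n)%N /\ (n < q.+1 * q.+1)%N.
Proof.
exists (Nat.sqrt n).
by have [/ssrnat.leP le /ssrnat.ltP lt] := Nat.sqrt_spec n (Nat.le_0_l n).
Qed.

Lemma chromatic_number_ge (p n q : nat) : prime p -> (0 < n)%N -> (q * q <= n)%N ->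
  (q.+1 <= chromatic_number (@cayS p n) * expn p 3)%N.
Proof.
move=> hp n0 le_qn; rewrite /chromatic_number; case: ex_minnP => k col _.
have [f f_proper] : exists f : 'rV['F_p]_n -> 'I_k,
    forall x y, x != y -> cayS x y -> f x != f y.
  case/existsP: col => f /forallP f_ok; exists f => x y nxy exy.
  by have /forallP/(_ y)/implyP := f_ok x; apply; rewrite nxy.
have k0 : (0 < k)%N := leq_ltn_trans (leq0n _) (ltn_ord (f (const_mx (GRing.one 'F_p)))).
have p1 := prime_gt1 hp.
have p3 : (p.-1 < expn p 3)%N.
  apply: (@leq_trans p); first by rewrite prednK // ltnW.
  by rewrite -{1}[p]expn1 leq_exp2l.
(* The 1 covers [n = 1]. Passing from [p.-1] to [p ^ 3] gains the unit by which [q.+1] exceeds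
   [q]. *)
suff le_q : (q <= maxn 1 (k * p.-1))%N.
  apply: leq_trans (_ : (k * (p.-1).+1 <= _)%N); last by rewrite leq_mul2l p3 orbT.
  by move: le_q; case: k k0 {f f_proper col} => // k _; rewrite leq_max; nia.
have [n1|n2] := leqP n 1; first by rewrite leq_max; apply/orP; left; nia.
have lt_qn : (q < n)%N by nia.
(* The allowed radius becomes [q], and [i.*2.+1] is [n] or [n.-1], so it exceeds [al] by at least
   [q]. *)
pose al := (n.-1 - q)%N; pose i := n.-1./2.
have Eal : (n - al.+1 = q)%N by rewrite /al; lia.
have ball (y y' : 'rV['F_p]_n) : y != y' ->
    (hamming (GRing.add y' (GRing.opp y)) (const_mx (GRing.one 'F_p)) <= n - al.+1)%N ->
    f y != f y'.
  rewrite Eal => nyy' /INR_leq le_h; apply: (f_proper) => //.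
  rewrite /cayS /cayley_rel nyy'; apply/orP; left; apply/S_ballE.
  have le_s := INR_le_sqrt le_qn; have p1' : (INR 1 <= INR p)%R := INR_leq (ltnW p1).
  apply: Rle_trans le_h (Rle_trans _ _ _ le_s _); rewrite -[X in (X <= _)%R]Rmult_1_l.
  by apply: Rmult_le_compat_r => //; apply: sqrt_pos.
have := flag_length_le hp ball (i := i).
have := odd_double_half n.-1; rewrite -/i => Ei.
move=> /(_ _) le_i; rewrite leq_max; apply/orP; right.
have le_in : (i.*2.+1 <= n)%N by lia.
by apply: leq_trans (le_i le_in); rewrite /al; lia.
Qed.

Lemma skewed_independent (p n r : nat) : prime p -> (n <= expn r 2)%N ->
  independent (@cayS p n) (skewed p n r).
Proof.
move=> hp le_nr.
have far (x y : 'rV['F_p]_n) : x \in skewed p n r -> y \in skewed p n r ->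
    GRing.add y (GRing.opp x) \notin @S_ball p n.
  move=> xA yA; apply/negP => /S_ballE le_h.
  have := skewed_far hp xA yA; rewrite ltnNge => /negP; apply.
  apply: INR_leqP; apply: Rle_trans le_h _; rewrite mult_INR.
  apply: Rmult_le_compat_l; first exact: pos_INR.
  by apply: sqrt_INR_le; rewrite mulnn.
apply/forall_inP => x xA; apply/forall_inP => y yA; apply/implyP => nxy.
by rewrite /cayS /cayley_rel nxy /= negb_or !far.
Qed.

Lemma independence_number_ge (p : nat) : prime p -> exists c : R, (0 < c)%R /\
  exists N : nat, forall n : nat, (N <= n)%N ->
    (c * INR p ^ n <= INR (independence_number (@cayS p n)))%R.
Proof.
move=> hp; have p1 := prime_gt1 hp.
(* With [b] at least r^2 / (8 p) and [M] at most b + (2 p + 13) r, the ratio M / b is at most 1 + D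
   / r; its power [L], of exponent (p + 4) r, is at most exp C. The threshold [t] below secures the
   bound on [b]. *)
pose D := (8 * p * (2 * p + 13))%N; pose C := (D * (p + 4))%N.
exists (exp (- INR C) / 2)%R; split; first by have := exp_pos (- INR C)%R; lra.
pose t := (8 * p * (p + 7))%N; exists (t * t)%N => n le_n.
have [q [le_q lt_q]] := nat_sqrt n; pose r := q.+1.
have r_gt : (t < r)%N by rewrite /r; nia.
have le_nr : (n <= expn r 2)%N by rewrite -mulnn ltnW.
have r2 : (r * r <= 4 * n)%N by rewrite /r; nia.
have r0 : (0 < r)%N by [].
have p0 : (0 < p)%N by apply: ltnW.
clearbody r; clear q le_q lt_q le_n.
have dn := divn_eq n p; have mn := ltn_pmod n p0.
set u := (n %/ p)%N in dn; set b := (u - (p + 6) * r)%N.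
have key : (r * r + 8 * p * ((p + 6) * r) <= 8 * p * u)%N.
  have : (8 * n <= 8 * p * u + 8 * p)%N by nia.
  have : (t * r <= r * r)%N by rewrite leq_mul2r ltnW ?orbT.
  have : (8 * p <= 8 * p * r)%N by nia.
  have Et : (t * r = 8 * p * ((p + 6) * r) + 8 * p * r)%N by rewrite /t; lia.
  by lia.
have le_u : ((p + 6) * r <= u)%N.
  by rewrite -(@leq_pmul2l (8 * p)) ?muln_gt0 // (leq_trans _ key) ?leq_addl.
have le_b : (r * r <= 8 * p * b)%N by rewrite /b mulnBr; lia.
have le_M : (r * (u + 1 + (p + 6) * r) <= b * (r + D))%N.
  have Eu : u = (b + (p + 6) * r)%N by rewrite /b subnK.
  have : ((2 * p + 13) * (r * r) <= (2 * p + 13) * (8 * p * b))%N.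
    by rewrite leq_mul2l le_b orbT.
  have := leq_pmulr r r0.
  by rewrite Eu /D; move: b {le_b Eu} => b; lia.
have b0 : (0 < b)%N.
  by case: b le_b {le_M} => //; rewrite muln0 leqNgt muln_gt0 r0.
have := card_skewed hp r0 le_nr le_u; rewrite -/u -/b.
set M := (u + 1 + _)%N in le_M *; set L := ((p + 4) * r)%N.
have leA : (#|skewed p n r| <= independence_number (@cayS p n))%N.
  apply: (leq_bigmax_cond (F := fun A : {set 'rV['F_p]_n} => #|A|)).
  exact: skewed_independent.
have leA' := INR_leq leA.
move=> count.
have le_count : (INR p ^ n * INR b ^ L <= INR 2 * INR #|skewed p n r| * INR M ^ L)%R.
  by rewrite -!INR_expn -!mult_INR; apply: INR_leq.
have r0' : (0 < INR r)%R by apply/lt_0_INR/ssrnat.ltP.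
have b0' : (0 < INR b)%R by apply/lt_0_INR/ssrnat.ltP.
have le_ratio : (INR M <= INR b * exp (INR D / INR r))%R.
  have le1 : (INR r * INR M <= INR b * (INR r + INR D))%R.
    by rewrite -plus_INR -!mult_INR; apply: INR_leq.
  have := exp_ineq1_le (INR D / INR r) => le2.
  apply: (Rle_trans _ (INR b * (1 + INR D / INR r))); last first.
    by apply: Rmult_le_compat_l le2; apply: Rlt_le.
  apply: (Rmult_le_reg_l (INR r)) => //; apply: Rle_trans le1 _; right.
  by field; lra.
have le_pow : (INR M ^ L <= INR b ^ L * exp (INR C))%R.
  apply: Rle_trans (_ : _ <= (INR b * exp (INR D / INR r)) ^ L)%R _.
    by apply: pow_incr; split => //; apply: pos_INR.
  right; rewrite Rpow_mult_distr; congr Rmult.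
  rewrite exp_pow; congr exp.
  have -> : INR L = ((INR p + INR 4) * INR r)%R by rewrite -plus_INR -mult_INR.
  have -> : INR C = (INR D * (INR p + INR 4))%R by rewrite -plus_INR -mult_INR.
  by field; lra.
have bL : (0 < INR b ^ L)%R by apply: pow_lt.
have E0 := exp_pos (INR C).
have le_p : (INR p ^ n <= 2 * INR #|skewed p n r| * exp (INR C))%R.
  apply: (Rmult_le_reg_r (INR b ^ L)) => //.
  apply: Rle_trans le_count _.
  have A0 : (0 <= 2 * INR #|skewed p n r|)%R.
    by have := pos_INR #|skewed p n r|; lra.
  have := Rmult_le_compat_l _ _ _ A0 le_pow => /=; lra.
apply: Rle_trans _ leA'.
have EE : (exp (- INR C) * exp (INR C) = 1)%R.
  by rewrite -exp_plus Rplus_opp_l exp_0.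
have E1 := exp_pos (- INR C).
have le2 := Rmult_le_compat_l _ _ _ (Rlt_le _ _ E1) le_p.
have E3 : (exp (- INR C) * (2 * INR #|skewed p n r| * exp (INR C)) =
           2 * INR #|skewed p n r|)%R.
  by rewrite Rmult_comm Rmult_assoc [(exp (INR C) * _)%R]Rmult_comm EE Rmult_1_r.
rewrite E3 in le2; move: le2; clear.
by move: (exp _) (pow _ _) (INR #|_|) => x y z; lra.
Qed.

Theorem theorem1p4 (p : nat) (hp : prime p) :
  (forall n : nat, (0 < n)%N ->
     (sqrt (INR n) / INR p ^ 3 <= INR (chromatic_number (@cayS p n)))%R) /\
  (exists c : R, (0 < c)%R /\
     exists N : nat, forall n : nat, (N <= n)%N ->
       (c * INR p ^ n <= INR (independence_number (@cayS p n)))%R).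
Proof.
split; last exact: independence_number_ge.
move=> n n0; have [q [le_q lt_q]] := nat_sqrt n.
have p3 : (0 < INR p ^ 3)%R by apply/pow_lt/lt_0_INR/ssrnat.ltP/prime_gt0.
apply: (Rmult_le_reg_r (INR p ^ 3)) => //.
rewrite /Rdiv Rmult_assoc Rinv_l; last by lra.
rewrite Rmult_1_r; apply: Rle_trans (sqrt_INR_le (ltnW lt_q)) _.
by rewrite -INR_expn -mult_INR; apply/INR_leq/chromatic_number_ge.
Qed.
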